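(* Let $\Gamma$ be a finite set of formulae of intuitionistic propositional logic and $\phi$ a formula. If $\Gamma\models\phi$, i.e. there exists a natural transformation $\llbracket\Gamma\rrbracket\to\llbracket\phi\rrbracket$ of presheaves on $\mathcal W$, then $\Gamma\vdash\phi$ is derivable in NJ.
   Context: Fix a countable set $\mathbb A$ of atoms; formulae are built from atoms and $\bot$ with $\wedge,\vee,\supset$. NJ is the standard natural deduction calculus for intuitionistic propositional logic in sequent form. An atomic rule is $\mathcal R=((P_1\Rightarrow q_1),\dots,(P_n\Rightarrow q_n))\Rightarrow r$ with $n\ge0$, $P_i$ finite sets of atoms, $q_i,r$ atoms. A base is a countable set of atomic rules. A context $(X:P)$ is a finite list $x_1:p_1,\dots,x_m:p_m$ of distinct variables with atoms. Derivation terms are $\Phi::=x\mid\Phi_{\mathcal R}(\Phi_1,\dots,\Phi_n)$; derivations in a base $\mathcal B$ are generated by (Ref) $(X:P),x:p\vdash_{\mathcal B}x:p$ and (App) if $\mathcal R\in\mathcal B$ and $(X:P),(X_i:P_i)\vdash_{\mathcal B}\Phi_i:q_i$ for all $i$, then $(X:P)\vdash_{\mathcal B}\Phi_{\mathcal R}(\Phi_1,\dots,\Phi_n):r$ (the $X_i$ bound). The category $\mathcal W$ has objects $(\mathcal B,(X:P))$; a morphism $(\mathcal B,(X:P))\to(\mathcal C,(Y:Q))$, $Y:Q=y_1:q_1,\dots,y_m:q_m$, exists only when $\mathcal C\subseteq\mathcal B$ and is a tuple of derivations $(X:P)\vdash_{\mathcal B}\Phi_i:q_i$; identities are variable tuples,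 composition is simultaneous substitution. For presheaves $F,G$ on $\mathcal W$: $F\times G$ pointwise; $(F\supset G)(w)=$ natural transformations $\mathcal W(-,w)\times F\to G$. Interpretation $\llbracket-\rrbracket$: $\llbracket p\rrbracket(\mathcal B,(X:P))$ = set of derivations $(X:P)\vdash_{\mathcal B}\Phi:p$, with action by substitution; $\llbracket\phi\wedge\psi\rrbracket=\llbracket\phi\rrbracket\times\llbracket\psi\rrbracket$; $\llbracket\phi\supset\psi\rrbracket=\llbracket\phi\rrbracket\supset\llbracket\psi\rrbracket$; $\llbracket\phi\vee\psi\rrbracket=\prod_{p\in\mathbb A}\big((\llbracket\phi\rrbracket\supset\llbracket p\rrbracket)\supset((\llbracket\psi\rrbracket\supset\llbracket p\rrbracket)\supset\llbracket p\rrbracket)\big)$; $\llbracket\bot\rrbracket=\prod_{p\in\mathbb A}\llbracket p\rrbracket$; $\llbracket\Gamma\rrbracket$ = product over $\Gamma$ (terminal if empty).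
   Formalization: The countable set of atoms is taken to be infinite; for any finite set of atoms the claim fails, since the set of all atoms then semantically entails ⊥ (whose interpretation is the product of all atoms) but does not derive ⊥ in NJ. *)

(* Defs.v *)
From HB Require Import structures.
From mathcomp Require Import all_boot.
From mathcomp Require Import finmap.
From mathcomp Require Import boolp classical_sets cardinality.

Set Implicit Arguments.
Unset Strict Implicit.
Unset Printing Implicit Defensive.

Local Open Scope fset_scope.

Inductive form (A : Type) : Type :=
| Atom of A
| Bot
| And of form A & form A
| Or of form A & form A
| Imp of form A & form A.
Arguments Bot {A}.

(* The encoding only serves to make [{fset form A}] available. *)
Section FormCountable.
Context (A : countType).

Fixpoint form_enc (f : form A) : GenTree.tree A :=
  match f with
  | Atom a => GenTree.Leaf a
  | Bot => GenTree.Node 0 [::]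
  | And f g => GenTree.Node 1 [:: form_enc f; form_enc g]
  | Or f g => GenTree.Node 2 [:: form_enc f; form_enc g]
  | Imp f g => GenTree.Node 3 [:: form_enc f; form_enc g]
  end.

Fixpoint form_dec (t : GenTree.tree A) : form A :=
  match t with
  | GenTree.Leaf a => Atom a
  | GenTree.Node 1 [:: t; u] => And (form_dec t) (form_dec u)
  | GenTree.Node 2 [:: t; u] => Or (form_dec t) (form_dec u)
  | GenTree.Node 3 [:: t; u] => Imp (form_dec t) (form_dec u)
  | GenTree.Node _ _ => Bot
  end.

Lemma form_encK : cancel form_enc form_dec.
Proof. by elim=> //= f -> g ->. Qed.

HB.instance Definition _ := Countable.copy (form A) (can_type form_encK).

End FormCountable.

Inductive NJ (A : countType) : {fset form A} -> form A -> Prop :=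
| NJ_ax G f : f \in G -> NJ G f
| NJ_botE G f : NJ G Bot -> NJ G f
| NJ_andI G f g : NJ G f -> NJ G g -> NJ G (And f g)
| NJ_andE1 G f g : NJ G (And f g) -> NJ G f
| NJ_andE2 G f g : NJ G (And f g) -> NJ G g
| NJ_orI1 G f g : NJ G f -> NJ G (Or f g)
| NJ_orI2 G f g : NJ G g -> NJ G (Or f g)
| NJ_orE G f g h :
    NJ G (Or f g) -> NJ (f |` G) h -> NJ (g |` G) h -> NJ G h
| NJ_impI G f g : NJ (f |` G) g -> NJ G (Imp f g)
| NJ_impE G f g : NJ G (Imp f g) -> NJ G f -> NJ G g.

Section Derivations.
Context (A : countType).

(* ((P_1 => q_1), ..., (P_n => q_n)) => r  is  ([:: (P_1, q_1); ...], r). *)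
Definition rule : Type := (seq ({fset A} * A) * A)%type.

Definition base : Type := set rule.

(* No countability requirement is needed in [base]: there are only countably
   many atomic rules. *)
Lemma base_countable (B : base) : countable B.
Proof. exact: countableP. Qed.

(* Derivation terms up to renaming of bound variables (locally nameless): the
   variables of a context (X : P) are names [FVar x], whereas those bound by the
   premises of a rule are de Bruijn indices [BVar k].  The i-th argument of
   [App R] binds one variable for each atom of P_i, in the order in which the
   finite set P_i is enumerated. *)
Inductive tm : Type :=
| FVar of nat
| BVar of nat
| App of rule & seq tm.

Record ctx : Type := Ctx { decls :> seq (nat * A); decls_uniq : uniq (unzip1 decls) }.

(* [typed B X D t p]: t is a derivation of p in B from the context X extended by
   the anonymous variables D, which are those bound above t (innermost first). *)
Inductive typed (B : base) (X : seq (nat * A)) : seq A -> tm -> A -> Prop :=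
| T_ref D x p : (x, p) \in X -> typed B X D (FVar x) p
| T_bref D k p : onth D k = Some p -> typed B X D (BVar k) p
| T_app D (R : rule) (ts : seq tm) :
    B R ->
    size ts = size R.1 ->
    (forall i t P q, onth ts i = Some t -> onth R.1 i = Some (P, q) ->
       typed B X ((P : seq A) ++ D) t q) ->
    typed B X D (App R ts) R.2.

Definition derivation (B : base) (X : seq (nat * A)) (p : A) : Type :=
  {t : tm | typed B X [::] t p}.

(* Simultaneous substitution.  The terms substituted are derivations, which have
   no dangling indices, so that no index shifting is needed under binders. *)
Fixpoint subst (s : nat -> tm) (t : tm) : tm :=
  match t with
  | FVar x => s x
  | BVar k => BVar k
  | App R ts => App R (map (subst s) ts)
  end.

(* y_i |-> t_i  when Y = y_1 : q_1, ..., y_m : q_m *)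
Definition assign (Y : seq (nat * A)) (ts : seq tm) (y : nat) : tm :=
  nth (FVar y) ts (index y (unzip1 Y)).

Lemma typed_weak B X D D' t p : typed B X D t p -> typed B X (D ++ D') t p.
Proof.
elim=> {D t p} [D x p|D k p Dk|D R ts BR sz _ IH].
- exact: T_ref.
- by apply: T_bref; rewrite onth_cat -onthTE Dk.
- apply: T_app => // i t P q /IH {}IH /IH; by rewrite catA.
Qed.

Lemma typed_mono B C X D t p :
  (C `<=` B)%classic -> typed C X D t p -> typed B X D t p.
Proof.
move=> CB; elim=> {D t p} [D x p|D k p|D R ts BR sz _ IH].
- exact: T_ref.
- exact: T_bref.
- by apply: T_app => //; apply: CB.
Qed.

Lemma typed_subst B C X Y s D t p :
  (C `<=` B)%classic ->
  (forall y q, (y, q) \in Y -> typed B X [::] (s y) q) ->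
  typed C Y D t p -> typed B X D (subst s t) p.
Proof.
move=> CB ss; elim=> {D t p} [D x p /ss /(@typed_weak _ _ _ D) //|D k p|].
  exact: T_bref.
move=> D R ts BR sz _ IH /=; apply: T_app; rewrite ?size_map //; first exact: CB.
move=> i t P q; rewrite onth_map; case E: (onth ts i) => [u|] //= [<-].
exact: IH.
Qed.

Lemma eq_subst B X D t p s s' : typed B X D t p ->
  (forall x q, (x, q) \in X -> s x = s' x) -> subst s t = subst s' t.
Proof.
move=> tt ss; elim: tt => {D t p} [D x p /ss //|//|D R ts _ sz _ IH] /=.
congr App; apply: eq_from_onth => i; rewrite !onth_map.
case E: (onth ts i) => [u|] //=; congr Some.
have: i < size R.1 by rewrite -sz -onthTE E.
rewrite -onthTE; case E': (onth R.1 i) => [[P q]|] // _.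
exact: IH E E'.
Qed.

Lemma subst_id B X D t p : typed B X D t p -> subst FVar t = t.
Proof.
elim=> {D t p} [//|//|D R ts _ sz _ IH] /=.
congr App; apply: eq_from_onth => i; rewrite !onth_map.
case E: (onth ts i) => [u|] //=; congr Some.
have: i < size R.1 by rewrite -sz -onthTE E.
rewrite -onthTE; case E': (onth R.1 i) => [[P q]|] // _.
exact: IH E E'.
Qed.

Fixpoint subst_subst s r t {struct t} :
  subst s (subst r t) = subst (fun x => subst s (r x)) t.
Proof.
case: t => [x|k|R ts] //=; congr App; rewrite -map_comp.
by elim: ts => //= t ts ->; rewrite subst_subst.
Qed.

End Derivations.

Section Category.
Context (A : countType).

Record obj : Type := Obj { obj_base : base A; obj_ctx : ctx A }.

(* A morphism from w = (B, (X : P)) to v = (C, (Y : Q)). *)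
Record hom (w v : obj) : Type := Hom {
  hom_base : (obj_base v `<=` obj_base w)%classic;
  hom_tm : (size (obj_ctx v)).-tuple (tm A);
  hom_typed : forall i : 'I_(size (obj_ctx v)),
    typed (obj_base w) (obj_ctx w) [::]
      (tnth hom_tm i) (tnth (in_tuple (obj_ctx v)) i).2 }.

Lemma hom_eq w v (f g : hom w v) : hom_tm f = hom_tm g -> f = g.
Proof.
case: f g => fb ft fP [gb gt gP] /= E; move: gP; rewrite -E => gP.
by rewrite (Prop_irrelevance fb gb) (Prop_irrelevance fP gP).
Qed.

Definition hom_sub w v (f : hom w v) : nat -> tm A :=
  assign (obj_ctx v) (hom_tm f).

Lemma index_decl (Y : ctx A) (i : 'I_(size Y)) :
  index (tnth (in_tuple Y) i).1 (unzip1 Y) = i.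
Proof.
set d := tnth _ i; have ->: d.1 = nth d.1 (unzip1 Y) i.
  by rewrite (nth_map d) // {1}/d (tnth_nth d).
by rewrite index_uniq ?size_map // decls_uniq.
Qed.

Lemma assign_tnth (Y : ctx A) (ts : (size Y).-tuple (tm A)) (i : 'I_(size Y)) :
  assign Y ts (tnth (in_tuple Y) i).1 = tnth ts i.
Proof. by rewrite /assign index_decl [RHS](tnth_nth (FVar A (tnth (in_tuple Y) i).1)). Qed.

Lemma declP (Y : ctx A) y q : (y, q) \in (Y : seq (nat * A)) ->
  exists i : 'I_(size Y), tnth (in_tuple Y) i = (y, q).
Proof. by case/(tnthP (in_tuple Y)) => i ->; exists i. Qed.

Lemma hom_sub_typed w v (f : hom w v) y q :
  (y, q) \in (obj_ctx v : seq (nat * A)) ->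
  typed (obj_base w) (obj_ctx w) [::] (hom_sub f y) q.
Proof.
case/declP => i E; have := hom_typed f i.
by rewrite -assign_tnth E.
Qed.

Program Definition hom_id (w : obj) : hom w w :=
  @Hom w w _ [tuple FVar A (tnth (in_tuple (obj_ctx w)) i).1
             | i < size (obj_ctx w)] _.
Next Obligation. by []. Qed.
Next Obligation.
rewrite tnth_mktuple; apply: T_ref; rewrite -surjective_pairing.
exact: (mem_tnth i (in_tuple (obj_ctx w))).
Qed.

Program Definition hom_comp (u w v : obj) (g : hom w v) (f : hom u w) :
    hom u v :=
  @Hom u v _ (map_tuple (subst (hom_sub f)) (hom_tm g)) _.
Next Obligation. by move=> x /(hom_base g) /(hom_base f). Qed.
Next Obligation.
rewrite tnth_map; apply: typed_subst (hom_typed g i).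
  exact: hom_base f.
exact: hom_sub_typed.
Qed.

Lemma hom_sub_id w x p : (x, p) \in (obj_ctx w : seq (nat * A)) ->
  hom_sub (hom_id w) x = FVar A x.
Proof.
case/declP => i E; rewrite /hom_sub -[x]/((x, p).1) -E assign_tnth.
by rewrite /= tnth_mktuple.
Qed.

Lemma hom_sub_comp u w v (g : hom w v) (f : hom u w) y q :
  (y, q) \in (obj_ctx v : seq (nat * A)) ->
  hom_sub (hom_comp g f) y = subst (hom_sub f) (hom_sub g y).
Proof.
case/declP => i E; rewrite /hom_sub -[y]/((y, q).1) -E !assign_tnth.
by rewrite /= tnth_map.
Qed.

Lemma hom_compf1 w v (f : hom w v) : hom_comp f (hom_id w) = f.
Proof.
apply/hom_eq/eq_from_tnth => i; rewrite /= tnth_map.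
rewrite (eq_subst (s' := @FVar A) (hom_typed f i)) => [|x q].
  exact: subst_id (hom_typed f i).
exact: hom_sub_id.
Qed.

Lemma hom_comp1f w v (f : hom w v) : hom_comp (hom_id v) f = f.
Proof.
apply/hom_eq/eq_from_tnth => i; rewrite /= tnth_map tnth_mktuple /=.
exact: assign_tnth.
Qed.

Lemma hom_compA u1 u2 u3 u4
    (h : hom u3 u4) (g : hom u2 u3) (f : hom u1 u2) :
  hom_comp h (hom_comp g f) = hom_comp (hom_comp h g) f.
Proof.
apply/hom_eq/eq_from_tnth => i; rewrite /= !tnth_map subst_subst.
apply: eq_subst (hom_typed h i) _ => x q.
exact: hom_sub_comp.
Qed.

Record psh : Type := Psh {
  at_obj :> obj -> Type;
  act : forall w v, hom w v -> at_obj v -> at_obj w;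
  act_id : forall w a, act (hom_id w) a = a;
  act_comp : forall u w v (g : hom w v) (f : hom u w) a,
    act (hom_comp g f) a = act f (act g a) }.

Record nat_trans (F G : psh) : Type := NatTrans {
  component :> forall w, F w -> G w;
  naturality : forall w v (f : hom w v) (a : F v),
    component (act f a) = act f (component a) }.

Lemma nat_trans_eq F G (s t : nat_trans F G) :
  (forall w a, s w a = t w a) -> s = t.
Proof.
case: s t => s sP [t tP] /= E.
have Est : s = t.
  by apply: functional_extensionality_dep => w;
     apply: functional_extensionality_dep => a.
by move: tP; rewrite -Est => tP; rewrite (Prop_irrelevance sP tP).
Qed.

Program Definition psh_prod (F G : psh) : psh :=
  @Psh (fun w => (F w * G w)%type)
       (fun w v f a => (act f a.1, act f a.2)) _ _.
Next Obligation. by rewrite /= !act_id. Qed.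
Next Obligation. by rewrite !act_comp. Qed.

Program Definition psh_bigprod (I : Type) (F : I -> psh) : psh :=
  @Psh (fun w => forall i, F i w) (fun w v f a i => act f (a i)) _ _.
Next Obligation.
by apply: functional_extensionality_dep => i; rewrite act_id.
Qed.
Next Obligation.
by apply: functional_extensionality_dep => i; rewrite act_comp.
Qed.

Program Definition yoneda (w : obj) : psh :=
  @Psh (fun v => hom v w) (fun v u f g => hom_comp g f) _ _.
Next Obligation. exact: hom_compf1. Qed.
Next Obligation. exact: hom_compA. Qed.

Program Definition psh_imp_act (F G : psh) (w v : obj) (f : hom w v)
    (s : nat_trans (psh_prod (yoneda v) F) G) :
    nat_trans (psh_prod (yoneda w) F) G :=
  @NatTrans (psh_prod (yoneda w) F) G
    (fun u a => s u (hom_comp f a.1, a.2)) _.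
Next Obligation. by rewrite hom_compA -naturality. Qed.

Program Definition psh_imp (F G : psh) : psh :=
  @Psh (fun w => nat_trans (psh_prod (yoneda w) F) G) (@psh_imp_act F G) _ _.
Next Obligation.
by apply: nat_trans_eq => v [g b] /=; rewrite hom_comp1f.
Qed.
Next Obligation.
by apply: nat_trans_eq => x [h b] /=; rewrite hom_compA.
Qed.

Definition derivation_act (p : A) (w v : obj) (f : hom w v)
    (d : derivation (obj_base v) (obj_ctx v) p) :
    derivation (obj_base w) (obj_ctx w) p :=
  exist _ (subst (hom_sub f) (sval d))
    (typed_subst (hom_base f) (@hom_sub_typed w v f) (svalP d)).

Program Definition psh_atom (p : A) : psh :=
  @Psh (fun w => derivation (obj_base w) (obj_ctx w) p) (@derivation_act p) _ _.
Next Obligation.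
apply: eq_sig_hprop => [*|]; first exact: Prop_irrelevance.
case: a => t tt /=.
by rewrite (eq_subst tt (@hom_sub_id w)) (subst_id tt).
Qed.
Next Obligation.
apply: eq_sig_hprop => [*|]; first exact: Prop_irrelevance.
case: a => t tt /=; rewrite subst_subst.
exact: eq_subst tt (hom_sub_comp g f).
Qed.

Fixpoint interp (f : form A) : psh :=
  match f with
  | Atom p => psh_atom p
  | Bot => psh_bigprod psh_atom
  | And f g => psh_prod (interp f) (interp g)
  | Or f g => psh_bigprod (fun p =>
      psh_imp (psh_imp (interp f) (psh_atom p))
              (psh_imp (psh_imp (interp g) (psh_atom p)) (psh_atom p)))
  | Imp f g => psh_imp (interp f) (interp g)
  end.

(* The index type [G] is the finite type of elements of the set G; for G empty the
   product is the terminal presheaf. *)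
Definition interp_ctx (G : {fset form A}) : psh :=
  psh_bigprod (fun f : G => interp (val f)).

Definition models (G : {fset form A}) (f : form A) : Prop :=
  inhabited (nat_trans (interp_ctx G) (interp f)).

End Category.

(* Main.v *)
(* Let [name] send each atom to a formula so that every formula is named and the
   atoms of the problem name themselves; this is possible because there are
   infinitely many atoms.  Take as base N all atomic rules which become sound for NJ
   once atoms are replaced by their names.  Over N, the presheaf [[f]] and any atom
   naming f admit maps in both directions, by induction on f: N contains the
   images of the NJ rules, and a natural map [[p]] -> [[q]], applied to a fresh
   variable of type p which is then abstracted, gives the premise of a rule
   discharging p.  A natural transformation [[G]] -> [[f]], applied to variables
   naming the formulae of G, thus gives a derivation in N of an atom naming f, and
   replacing atoms by their names turns it into an NJ proof. *)

Require Import Defs.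
From mathcomp Require Import all_boot finmap.
From mathcomp Require Import boolp classical_sets cardinality.

Set Implicit Arguments.
Unset Strict Implicit.
Unset Printing Implicit Defensive.

Local Open Scope fset_scope.

(** * Zipping the premises of a rule with its arguments *)

Section ZipWith.
Context (S T U : Type) (f : S -> T -> U).

(** Recursion on the second list, with [f] fixed outside, lets [close] call itself through
    [zip_with] under the guard condition. *)
Fixpoint zip_with (ss : seq S) (ts : seq T) {struct ts} : seq U :=
  match ts, ss with
  | t :: ts, s :: ss => f s t :: zip_with ss ts
  | _, _ => [::]
  end.

Lemma size_zip_with ss ts : size ts = size ss -> size (zip_with ss ts) = size ss.
Proof. by elim: ss ts => [|s ss IH] [|t ts] //= [/IH ->]. Qed.

Lemma onth_zip_with ss ts i u : onth (zip_with ss ts) i = Some u ->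
  exists s t, [/\ onth ss i = Some s, onth ts i = Some t & u = f s t].
Proof.
elim: ts ss i => [|t ts IH] [|s ss] [|i] //=; last exact: IH.
by case=> <-; exists s, t.
Qed.

End ZipWith.

(** * Turning a free variable of a derivation into a bound one *)

Section Abstraction.
Context (A : countType).
Implicit Types (X Y : seq (nat * A)) (B C : base A) (t : tm A).

(* Below [App R] the index replacing [x] grows by
   the number of variables bound by the premise at hand. *)
Fixpoint close (x k : nat) t : tm A :=
  match t with
  | FVar y => if y == x then BVar A k else FVar A y
  | BVar j => BVar A j
  | App R ts =>
      App R (zip_with (fun pr => close x (size (enum_fset pr.1) + k)) R.1 ts)
  end.

(** The new binder lies outside those of [D], which are listed innermost first; hence the index
    [size D] and the place of [p] at the end. *)
Lemma close_typed B X x p D t q : x \notin unzip1 X ->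
  typed B ((x, p) :: X) D t q -> typed B X (D ++ [:: p]) (close x (size D) t) q.
Proof.
move=> xX; elim=> {D t q} [D y q|D k q Dk|D R ts BR sz _ IH].
- rewrite inE => /orP[/eqP[-> ->]|yX] /=.
    by rewrite eqxx; apply: T_bref; rewrite onth_cat ltnn subnn.
  case: eqP => [E|_]; last exact: T_ref.
  by move: xX; rewrite -E -[y]/((y, q).1) map_f.
- by apply: T_bref; rewrite onth_cat -onthTE Dk.
- apply: T_app; rewrite ?size_zip_with //.
  move=> i u P q Eu EP; have [pr [t [Epr Et ->]]] := onth_zip_with Eu.
  have -> /= : pr = (P, q) by move: Epr; rewrite EP => -[].
  by rewrite catA -size_cat; exact: IH Et EP.
Qed.

Lemma close_fresh B X D t q x k : x \notin unzip1 X ->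
  typed B X D t q -> close x k t = t.
Proof.
move=> xX tt; elim: tt k => {D t q} [D y q yX|//|D R ts _ sz _ IH] k.
  rewrite /=; case: eqP => // E.
  by move: xX; rewrite -E -[y]/((y, q).1) map_f.
rewrite /=; congr App.
elim: {R}R.1 ts sz IH => [|[P q] prs IHp] [|t ts] //= [sz] IH.
rewrite (IH 0 t P q) // IHp // => i u P' q'; exact: (IH i.+1).
Qed.

(** This is what makes abstraction natural: [s'] plays the role of [s] lifted to the extended
    contexts, and nothing is captured because closing [x] leaves the substituted terms unchanged. *)
Lemma close_subst C Y D t q x y p s s' k :
  (forall z r, (z, r) \in Y ->
     s' z = s z /\ forall k, close x k (s z) = s z) ->
  y \notin unzip1 Y -> s' y = FVar A x ->
  typed C ((y, p) :: Y) D t q ->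
  close x k (subst s' t) = subst s (close y k t).
Proof.
move=> ss yY s'y tt; elim: tt k => {D t q} [D z q zY|//|D R ts _ sz _ IH] k.
  move: zY; rewrite inE => /orP[/eqP[-> _]|zY] /=; first by rewrite s'y /= !eqxx.
  case: eqP => [E|_] /=; last by have [-> ->] := ss _ _ zY.
  by move: yY; rewrite -E -[z]/((z, q).1) map_f.
rewrite /=; congr App.
elim: {R}R.1 ts sz IH => [|[P q] prs IHp] [|t ts] //= [sz] IH.
rewrite (IH 0 t P q) // IHp // => i u P' q'; exact: (IH i.+1).
Qed.

Definition fresh X : nat := (\max_(x <- unzip1 X) x).+1.

Lemma freshP X : fresh X \notin unzip1 X.
Proof.
apply/negP => xX; have := leq_bigmax_seq (P := xpredT) (F := id) _ xX isT.
by rewrite {1}/fresh ltnn.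
Qed.

End Abstraction.

(** * Morphisms given by substitutions; context extension, weakening and lifting *)

Section Homs.
Context (A : countType).
Implicit Types (w v u : obj A).

Lemma hom_ext w v (f g : hom w v) :
  (forall y q, (y, q) \in (obj_ctx v : seq (nat * A)) ->
     hom_sub f y = hom_sub g y) -> f = g.
Proof.
move=> E; apply/hom_eq/eq_from_tnth => i.
rewrite -!assign_tnth; apply: (E _ (tnth (in_tuple (obj_ctx v)) i).2).
rewrite -surjective_pairing; exact: (mem_tnth i (in_tuple (obj_ctx v))).
Qed.

Section HomOfSubst.
Context w v (s : nat -> tm A) (vw : (obj_base v `<=` obj_base w)%classic).
Hypothesis ss : forall y q, (y, q) \in (obj_ctx v : seq (nat * A)) ->
  typed (obj_base w) (obj_ctx w) [::] (s y) q.

Lemma hom_of_subst_typed (i : 'I_(size (obj_ctx v))) :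
  typed (obj_base w) (obj_ctx w) [::]
    (tnth [tuple s (tnth (in_tuple (obj_ctx v)) i).1 | i < size (obj_ctx v)] i)
    (tnth (in_tuple (obj_ctx v)) i).2.
Proof.
rewrite tnth_mktuple; apply: ss; rewrite -surjective_pairing.
exact: (mem_tnth i (in_tuple (obj_ctx v))).
Qed.

Definition hom_of_subst : hom w v := Hom vw hom_of_subst_typed.

Lemma hom_of_substE y q : (y, q) \in (obj_ctx v : seq (nat * A)) ->
  hom_sub hom_of_subst y = s y.
Proof.
case/declP => i E; rewrite /hom_sub -[y]/((y, q).1) -E assign_tnth.
by rewrite tnth_mktuple.
Qed.

End HomOfSubst.

Definition fresh_of w : nat := fresh (obj_ctx w).

Lemma ext_uniq w p : uniq (unzip1 ((fresh_of w, p) :: obj_ctx w)).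
Proof. by rewrite /= freshP decls_uniq. Qed.

Definition ext w p : obj A := Obj (obj_base w) (Ctx (ext_uniq w p)).

Lemma ext_var w p : (fresh_of w, p) \in (obj_ctx (ext w p) : seq (nat * A)).
Proof. by rewrite /= inE eqxx. Qed.

Lemma ext_old w p y q : (y, q) \in (obj_ctx w : seq (nat * A)) ->
  (y, q) \in (obj_ctx (ext w p) : seq (nat * A)).
Proof. by rewrite /= inE => ->; rewrite orbT. Qed.

Definition wk w p : hom (ext w p) w.
Proof.
apply: (@hom_of_subst (ext w p) w (@FVar A)) => // y q yq.
exact/T_ref/ext_old.
Defined.

Lemma wkE w p y q : (y, q) \in (obj_ctx w : seq (nat * A)) ->
  hom_sub (wk w p) y = FVar A y.
Proof. exact: hom_of_substE. Qed.

Definition lift_sub w v (f : hom w v) (y : nat) : tm A :=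
  if y == fresh_of v then FVar A (fresh_of w) else hom_sub f y.

Lemma lift_sub_old w v (f : hom w v) y q :
  (y, q) \in (obj_ctx v : seq (nat * A)) -> lift_sub f y = hom_sub f y.
Proof.
move=> yq; rewrite /lift_sub; case: eqP => // E.
by have := freshP (obj_ctx v); rewrite -/(fresh_of v) -E -[y]/((y, q).1) map_f.
Qed.

Definition lift w v (f : hom w v) p : hom (ext w p) (ext v p).
Proof.
apply: (@hom_of_subst (ext w p) (ext v p) (lift_sub f)); first exact: hom_base f.
move=> y q; rewrite /= inE => /orP[/eqP[-> ->]|yq].
  by rewrite /lift_sub eqxx; apply: T_ref; apply: ext_var.
rewrite (lift_sub_old f yq).
rewrite -[hom_sub f y](subst_id (hom_sub_typed f yq)).
by apply: typed_subst (hom_sub_typed f yq) => // z r zr; apply/T_ref/ext_old.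
Defined.

Lemma lift_var w v (f : hom w v) p :
  hom_sub (lift f p) (fresh_of v) = FVar A (fresh_of w).
Proof. by rewrite (hom_of_substE _ _ (ext_var v p)) /lift_sub eqxx. Qed.

Lemma lift_old w v (f : hom w v) p y q :
  (y, q) \in (obj_ctx v : seq (nat * A)) -> hom_sub (lift f p) y = hom_sub f y.
Proof.
by move=> yq; rewrite (hom_of_substE _ _ (ext_old p yq)) (lift_sub_old f yq).
Qed.

Lemma wk_lift w v (f : hom w v) p :
  hom_comp (wk v p) (lift f p) = hom_comp f (wk w p).
Proof.
apply: hom_ext => y q yq; rewrite !(hom_sub_comp _ _ yq) (wkE _ yq) /=.
rewrite (lift_old f p yq).
rewrite (eq_subst (s' := @FVar A) (hom_sub_typed f yq)) => [|z r].
  by rewrite (subst_id (hom_sub_typed f yq)).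
exact: wkE.
Qed.

End Homs.

(** * Cartesian closed structure of presheaves, and atomic rules acting on natural families *)

Section Entailment.
Context (A : countType).
Implicit Types (F G H : psh A) (w v u : obj A) (p q r : A).

Definition entails F G : Prop := inhabited (nat_trans F G).
Local Notation "F |- G" := (entails F G) (at level 70).

Lemma entails_refl F : F |- F.
Proof. by constructor; apply: (@NatTrans _ F F (fun w a => a)). Qed.

Lemma entails_trans G F H : F |- G -> G |- H -> F |- H.
Proof.
case=> s [t]; constructor.
apply: (@NatTrans _ F H (fun w a => t w (s w a))) => w v f a.
by rewrite !naturality.
Qed.

Lemma entails_pair F G H : F |- psh_prod G H <-> F |- G /\ F |- H.
Proof.
split=> [[s]|[[s] [t]]].
  split; constructor.
    apply: (@NatTrans _ F G (fun w a => (s w a).1)) => w v f a.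
    by rewrite naturality.
  apply: (@NatTrans _ F H (fun w a => (s w a).2)) => w v f a.
  by rewrite naturality.
constructor; apply: (@NatTrans _ F (psh_prod G H) (fun w a => (s w a, t w a))).
by move=> w v f a; rewrite !naturality.
Qed.

Lemma entails_fst F G : psh_prod F G |- F.
Proof. by have /entails_pair[] := entails_refl (psh_prod F G). Qed.

Lemma entails_snd F G : psh_prod F G |- G.
Proof. by have /entails_pair[] := entails_refl (psh_prod F G). Qed.

Lemma entails_bigprod F (I : Type) (G : I -> psh A) :
  F |- psh_bigprod G <-> forall i, F |- G i.
Proof.
split=> [[s] i|FG].
  constructor; apply: (@NatTrans _ F (G i) (fun w a => s w a i)) => w v f a.
  by rewrite naturality.
(* Any choice of one transformation per index will do, since naturality into the product is checked
   componentwise. *)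
have s i : nat_trans F (G i).
  have : exists t : nat_trans F (G i), True by have [t] := FG i; exists t.
  by case/cid.
constructor; apply: (@NatTrans _ F (psh_bigprod G) (fun w a i => s i w a)).
move=> w v f a; apply: functional_extensionality_dep => i.
by rewrite naturality.
Qed.

Lemma curry_natural F G H (s : nat_trans (psh_prod F G) H) v (a : F v)
    w u (f : hom w u) (b : psh_prod (yoneda v) G u) :
  s w (act (act f b).1 a, (act f b).2) = act f (s u (act b.1 a, b.2)).
Proof. by rewrite -naturality /= act_comp. Qed.

Definition curry F G H (s : nat_trans (psh_prod F G) H) v (a : F v) :
  psh_imp G H v := @NatTrans _ (psh_prod (yoneda v) G) H _ (curry_natural s a).

Lemma entails_imp F G H : F |- psh_imp G H <-> psh_prod F G |- H.
Proof.
split=> [[s]|[s]]; constructor.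
  (* Evaluation takes the component of the exponential at the identity of [w]. *)
  apply: (@NatTrans _ (psh_prod F G) H
            (fun w a => s w a.1 w (hom_id w, a.2))) => w v f [a b] /=.
  rewrite naturality /= hom_compf1 -naturality /=.
  by rewrite hom_comp1f.
apply: (@NatTrans _ F (psh_imp G H) (curry s)) => w v f a.
by apply: nat_trans_eq => u [g b] /=; rewrite act_comp.
Qed.

Lemma entails_app F G H : F |- psh_imp G H -> F |- G -> F |- H.
Proof.
move=> /entails_imp FGH FG; apply: entails_trans FGH.
by apply/entails_pair; split=> //; apply: entails_refl.
Qed.

(* Natural families of derivations that may use bound variables D, as required for
   the premises of a rule; for D empty these are the maps into [psh_atom q]. *)
Definition term_family F (D : seq A) q : Prop :=
  exists2 t : forall w, F w -> tm A,
    forall w a, typed (obj_base w) (obj_ctx w) D (t w a) q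
  & forall w v (f : hom w v) a, t w (act f a) = subst (hom_sub f) (t v a).

Lemma derivation_eq (B : base A) (X : seq (nat * A)) q (d e : derivation B X q) :
  sval d = sval e -> d = e.
Proof. by apply: eq_sig_hprop => *; apply: Prop_irrelevance. Qed.

Lemma entails_atom F q : F |- psh_atom q <-> term_family F [::] q.
Proof.
split=> [[s]|[t tt tN]].
  exists (fun w a => sval (s w a)) => [w a|w v f a]; first exact: (svalP (s w a)).
  by rewrite naturality.
pose d w a : derivation (obj_base w) (obj_ctx w) q := exist _ (t w a) (tt w a).
constructor; apply: (@NatTrans _ F (psh_atom q) d) => w v f a.
by apply: derivation_eq; apply: tN.
Qed.

(** The fresh names picked at different objects are unrelated, but closing erases them; naturality
    along [f] then comes from that of [s] along [lift f p]. *)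
Lemma term_family_bind F p q :
  psh_prod F (psh_atom p) |- psh_atom q -> term_family F [:: p] q.
Proof.
case=> s.
have var_typed w : typed (obj_base (ext w p)) (obj_ctx (ext w p)) [::]
    (FVar A (fresh_of w)) p by exact/T_ref/ext_var.
pose body w (a : F w) := s (ext w p) (act (wk w p) a, exist _ _ (var_typed w)).
exists (fun w a => close (fresh_of w) 0 (sval (body w a))) => [w a|w v f a].
  exact: (close_typed (freshP (obj_ctx w)) (svalP (body w a))).
have -> : body w (act f a) = act (lift f p) (body v a).
  rewrite /body -naturality /= -!act_comp wk_lift.
  apply: f_equal; apply: f_equal.
  by apply: derivation_eq; rewrite /= lift_var.
have bt : typed (obj_base v) ((fresh_of v, p) :: obj_ctx v) [::]
    (sval (body v a)) q := svalP (body v a).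
apply: (close_subst _ _ (freshP (obj_ctx v)) _ bt).
  move=> z r zr; rewrite (lift_old f p zr); split=> // k.
  exact: close_fresh (freshP _) (hom_sub_typed f zr).
exact: lift_var.
Qed.

(** Guarantees that the rules of [B] may be applied wherever [F] has an element. *)
Definition over B F : Prop := forall w, F w -> (B `<=` obj_base w)%classic.

Lemma over_prod B F G : over B F -> over B (psh_prod F G).
Proof. by move=> BF w [/BF]. Qed.

(** An iterated conjunction, so that for a concrete rule it computes to one conjunct per premise. *)
Fixpoint premises (Q : {fset A} -> A -> Prop) (prs : seq ({fset A} * A)) : Prop :=
  if prs is (P, q) :: prs then Q P q /\ premises Q prs else True.

Lemma entails_rule (B : base A) F (R : rule A) : over B F -> B R ->
  premises (fun P => term_family F (P : seq A)) R.1 -> F |- psh_atom R.2.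
Proof.
move=> BF BR FR; apply/entails_atom.
(* The families for the separate premises are gathered into one natural family of argument lists. *)
have [ts [tsz tst tsN]] : exists ts : forall w, F w -> seq (tm A),
    [/\ forall w a, size (ts w a) = size R.1,
        forall w a i t P q, onth (ts w a) i = Some t ->
          onth R.1 i = Some (P, q) ->
          typed (obj_base w) (obj_ctx w) (P : seq A) t q
      & forall w v (f : hom w v) a,
          ts w (act f a) = map (subst (hom_sub f)) (ts v a)].
  elim: {BR}R.1 FR => [|[P q] prs IH] /=.
    by exists (fun _ _ => [::]); split=> // w a [].
  case=> -[t tt tN] /IH[ts [tsz tst tsN]].
  exists (fun w a => t w a :: ts w a); split=> [w a|w a [|i] u P' q'|w v f a] /=.
  - by rewrite tsz.
  - by case=> <- [<- <-].
  - exact: tst.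
  - by rewrite tN tsN.
exists (fun w a => App R (ts w a)) => [w a|w v f a]; last by rewrite tsN.
apply: T_app => //; first exact: BF a _ BR.
by move=> i t P q Et EP; rewrite cats0; apply: tst Et EP.
Qed.

Lemma premise0 F q :
  F |- psh_atom q -> term_family F ((fset0 : {fset A}) : seq A) q.
Proof. by move/entails_atom. Qed.

Lemma premise1 F p q : psh_prod F (psh_atom p) |- psh_atom q ->
  term_family F ([fset p] : seq A) q.
Proof. by move/term_family_bind; rewrite enum_fsetE enum_fset1. Qed.

End Entailment.

Local Notation "F |- G" := (entails F G) (at level 70).

(** * The base of sound rules simulates NJ *)

Section Simulation.
Context (A : countType) (name : A -> form A).
Implicit Types (F : psh A) (G : {fset form A}).

Lemma named0 G : [fset name a | a in fset0] `|` G = G.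
Proof. by rewrite imfset0 fset0U. Qed.

Lemma named1 p G : [fset name a | a in [fset p]] `|` G = name p |` G.
Proof. by rewrite imfset_fset1. Qed.

Definition named := (named0, named1).

(* The whole semantic class of sound rules is taken, so that reading derivations
   back in NJ is immediate. *)
Definition sound_rules : base A := fun R => forall G,
  premises (fun P q => NJ ([fset name a | a in P] `|` G) (name q)) R.1 ->
  NJ G (name R.2).

(** Free and bound variables both become hypotheses, and rule applications are sound by the choice
    of base. [G] varies in the induction because premises enlarge it. *)
Lemma typed_sound X D t p G : typed sound_rules X D t p ->
  (forall x q, (x, q) \in X -> name q \in G) ->
  {in D, forall q, name q \in G} -> NJ G (name p).
Proof.
move=> tt XG; elim: tt G XG => {D t p} [D x p xX G XG _|D k p Dk G _ DG|].
- exact/NJ_ax/(XG x).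
- by apply/NJ_ax/DG/onthP; exists k.
move=> D R ts NR sz _ IH G XG DG; apply: NR.
elim: R.1 ts sz IH => [|[P q] prs IHp] [|t ts] //= [sz] IH.
split; last by apply: (IHp ts) => // i; apply: (IH i.+1).
apply: (IH 0 t P q) => // [x r /XG|r].
  by rewrite inE orbC => ->.
rewrite mem_cat inE => /orP[rP|/DG ->]; last by rewrite orbT.
by rewrite in_imfset.
Qed.

(** Several atoms may name one formula; the rule leading from one such atom to another is sound. *)
Lemma entails_named F p q : over sound_rules F -> name p = name q ->
  F |- psh_atom p -> F |- psh_atom q.
Proof.
move=> NF E Fp.
apply: (@entails_rule _ sound_rules _ ([:: (fset0, p)], q)) => //=.
  by move=> G /=; rewrite named0 E => -[].
by split=> //; apply: premise0.
Qed.

Lemma entails_Bot F b p : over sound_rules F -> name b = Bot ->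
  F |- psh_atom b -> F |- psh_atom p.
Proof.
move=> NF E Fb.
apply: (@entails_rule _ sound_rules _ ([:: (fset0, b)], p)) => //=.
  by move=> G /=; rewrite named0 E => -[/NJ_botE].
by split=> //; apply: premise0.
Qed.

Lemma entails_And F a p q : over sound_rules F ->
  name a = And (name p) (name q) ->
  F |- psh_atom a <-> F |- psh_atom p /\ F |- psh_atom q.
Proof.
move=> NF E; split=> [Fa|[Fp Fq]].
  split.
    apply: (@entails_rule _ sound_rules _ ([:: (fset0, a)], p)) => //=.
      by move=> G /=; rewrite named0 E => -[/NJ_andE1].
    by split=> //; apply: premise0.
  apply: (@entails_rule _ sound_rules _ ([:: (fset0, a)], q)) => //=.
    by move=> G /=; rewrite named0 E => -[/NJ_andE2].
  by split=> //; apply: premise0.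
apply: (@entails_rule _ sound_rules _ ([:: (fset0, p); (fset0, q)], a)) => //=.
  by move=> G /=; rewrite !named0 E => -[Gp [Gq _]]; apply: NJ_andI.
by split; [|split=> //]; apply: premise0.
Qed.

Lemma entails_Imp F a p q : over sound_rules F ->
  name a = Imp (name p) (name q) ->
  F |- psh_atom a <-> psh_prod F (psh_atom p) |- psh_atom q.
Proof.
move=> NF E; split=> [Fa|Fpq].
  apply: (@entails_rule _ sound_rules _ ([:: (fset0, a); (fset0, p)], q)) => //=.
  - exact: over_prod.
  - by move=> G /=; rewrite !named0 E => -[Ga [Gp _]]; apply: NJ_impE Ga Gp.
  split; last by split=> //; apply/premise0/entails_snd.
  by apply/premise0/(entails_trans _ Fa)/entails_fst.
apply: (@entails_rule _ sound_rules _ ([:: ([fset p], q)], a)) => //=.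
  by move=> G /=; rewrite named1 E => -[/NJ_impI].
by split=> //; apply: premise1.
Qed.

Lemma entails_Or1 F a p q : over sound_rules F ->
  name a = Or (name p) (name q) -> F |- psh_atom p -> F |- psh_atom a.
Proof.
move=> NF E Fp.
apply: (@entails_rule _ sound_rules _ ([:: (fset0, p)], a)) => //=.
  by move=> G /=; rewrite named0 E => -[/NJ_orI1].
by split=> //; apply: premise0.
Qed.

Lemma entails_Or2 F a p q : over sound_rules F ->
  name a = Or (name p) (name q) -> F |- psh_atom q -> F |- psh_atom a.
Proof.
move=> NF E Fq.
apply: (@entails_rule _ sound_rules _ ([:: (fset0, q)], a)) => //=.
  by move=> G /=; rewrite named0 E => -[/NJ_orI2].
by split=> //; apply: premise0.
Qed.

Lemma entails_OrE F a p q r : over sound_rules F ->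
  name a = Or (name p) (name q) -> F |- psh_atom a ->
  psh_prod F (psh_atom p) |- psh_atom r ->
  psh_prod F (psh_atom q) |- psh_atom r -> F |- psh_atom r.
Proof.
move=> NF E Fa Fp Fq.
apply: (@entails_rule _ sound_rules _
          ([:: (fset0, a); ([fset p], r); ([fset q], r)], r)) => //=.
  move=> G /=; rewrite !named E => -[Ga [Gp [Gq _]]].
  exact: NJ_orE Ga Gp Gq.
by split; [exact: premise0|split; [|split=> //]; exact: premise1].
Qed.

Fixpoint atoms (f : form A) : seq A :=
  match f with
  | Atom p => [:: p]
  | Bot => [::]
  | And f g | Or f g | Imp f g => atoms f ++ atoms g
  end.

Hypothesis name_surj : forall f, exists a, name a = f.

(* Quantifying over all F over N replaces the construction of the natural maps
   between [[f]] and the atom naming it, and hides their naturality. *)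
Lemma entails_interp f : all (fun p => name p == Atom p) (atoms f) ->
  forall a F, name a = f -> over sound_rules F ->
  F |- interp f <-> F |- psh_atom a.
Proof.
elim: f => [p||g IHg h IHh|g IHg h IHh|g IHg h IHh] /=; rewrite ?all_cat.
- rewrite andbT => /eqP Ep a F Ea NF; rewrite -Ea in Ep.
  by split; apply: entails_named.
- move=> _ a F Ea NF; rewrite entails_bigprod; split=> [/(_ a) //|Fa p].
  exact: entails_Bot Ea Fa.
- move=> /andP[Ug Uh] a F Ea NF.
  have [[p Ep] [q Eq]] := (name_surj g, name_surj h).
  rewrite entails_pair (IHg Ug p F Ep NF) (IHh Uh q F Eq NF).
  by rewrite (entails_And NF (a := a) (p := p) (q := q)) ?Ep ?Eq.
- move=> /andP[Ug Uh] a F Ea NF.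
  have [[p Ep] [q Eq]] := (name_surj g, name_surj h).
  have Eapq : name a = Or (name p) (name q) by rewrite Ep Eq.
  (* The second-order disjunction is instantiated at [a] itself, where the or-introduction rules
     supply both arguments. *)
  split=> [/entails_bigprod/(_ a) Fa|Fa].
    apply: (entails_app (entails_app Fa _)); apply/entails_imp.
      apply: (entails_Or1 (over_prod NF) Eapq).
      exact/(IHg Ug p _ Ep (over_prod NF))/entails_snd.
    apply: (entails_Or2 (over_prod NF) Eapq).
    exact/(IHh Uh q _ Eq (over_prod NF))/entails_snd.
  (* Conversely, or-elimination into an arbitrary atom [r], whose two cases are the hypotheses just
     introduced. *)
  apply/entails_bigprod => r; apply/entails_imp/entails_imp.
  set F2 := psh_prod _ _.
  have NF2 : over sound_rules F2 by do 2!apply: over_prod.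
  have F2F : F2 |- F by apply: entails_trans (entails_fst _ _) (entails_fst _ _).
  apply: (entails_OrE NF2 Eapq (entails_trans F2F Fa)).
    apply: (@entails_app _ _ (interp g)).
      apply: entails_trans (entails_fst _ _) _.
      exact: entails_trans (entails_fst _ _) (entails_snd _ _).
    exact/(IHg Ug p _ Ep (over_prod NF2))/entails_snd.
  apply: (@entails_app _ _ (interp h)).
    exact: entails_trans (entails_fst _ _) (entails_snd _ _).
  exact/(IHh Uh q _ Eq (over_prod NF2))/entails_snd.
- move=> /andP[Ug Uh] a F Ea NF.
  have [[p Ep] [q Eq]] := (name_surj g, name_surj h).
  have Eapq : name a = Imp (name p) (name q) by rewrite Ep Eq.
  (* Both sides now entail [q] and differ only in whether the antecedent is [interp g] or the atom
     [p] naming [g]. *)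
  rewrite entails_imp (IHh Uh q _ Eq (over_prod NF)) (entails_Imp NF Eapq).
  split=> Fg; apply: entails_trans Fg; apply/entails_pair.
    split; first exact: entails_fst.
    exact/(IHg Ug p _ Ep (over_prod NF))/entails_snd.
  split; first exact: entails_fst.
  exact/(IHg Ug p _ Ep (over_prod NF))/entails_snd.
Qed.

End Simulation.

(** * Naming formulae by atoms, and completeness *)

Lemma exists_name (A : countType) (U : seq A) : infinite_set [set: A]%classic ->
  exists2 name : A -> form A, {in U, forall p, name p = Atom p}
                            & forall f, exists a, name a = f.
Proof.
move=> Ainf.
(* The atoms outside the finite [U] are still infinitely many, so [g] maps them onto the natural
   numbers, which code formulae. *)
have /infiniteP/pcard_surjP[g gsurj] := infinite_setD Ainf (finite_seq U).
(* [Bot] is the default for numbers that code no formula. *)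
exists (fun a => if a \in U then Atom a else odflt Bot (choice.unpickle (g a : nat))).
  by move=> p ->.
move=> f; have [a [_ /negP aU] ga] := gsurj (choice.pickle f) I.
by exists a; rewrite (negbTE aU) ga choice.pickleK.
Qed.

Theorem theorem22 (A : countType) (A_infinite : infinite_set [set: A]%classic)
    (G : {fset form A}) (f : form A) :
  models G f -> NJ G f.
Proof.
move=> Gf; pose U := flatten [seq atoms h | h <- f :: enum_fset G].
have [name nameU name_surj] := exists_name U A_infinite.
have Uh h : h \in f :: enum_fset G -> all (fun p => name p == Atom p) (atoms h).
  move=> hG; apply/allP => p ph; apply/eqP/nameU/flattenP.
  by exists (atoms h); rewrite ?map_f.
have [code codeK] := choice name_surj.
(* Codes of the formulae serve as variable names, which makes them distinct. *)
pose X := [seq (choice.pickle h, code h) | h <- enum_fset G].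
have uX : uniq (unzip1 X).
  rewrite /X /unzip1 -map_comp map_inj_uniq ?fset_uniq //.
  exact: (pcan_inj choice.pickleK).
pose w := Obj (sound_rules name) (Ctx uX).
(* The representable presheaf of [w] stands in for the interpretation of [G]: morphisms into [w]
   exist only from larger bases, and their components at the variables of [X] are the derivations
   required. *)
have Nw : over (sound_rules name) (yoneda w) by move=> v; apply: hom_base.
have wG : yoneda w |- interp_ctx G.
  apply/entails_bigprod => h.
  have hG : val h \in f :: enum_fset G by rewrite inE (valP h) orbT.
  apply/(entails_interp name_surj (Uh _ hG) (codeK _) Nw)/entails_atom.
  have hX : (choice.pickle (val h), code (val h)) \in X by apply: map_f; apply: valP.
  exists (fun v s => hom_sub s (choice.pickle (val h))) => [v s|v u s t].
    exact: (hom_sub_typed s hX).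
  exact: (hom_sub_comp t s hX).
have /(entails_interp name_surj (Uh _ (mem_head _ _)) (codeK f) Nw) :=
  entails_trans wG Gf.
case/entails_atom => t tt _.
(* As in the Yoneda lemma, the identity of [w] yields a derivation in the context [X] itself. *)
rewrite -(codeK f); apply: typed_sound (tt w (hom_id w)) _ _ => // x q.
by case/mapP => h hG [_ ->]; rewrite codeK.
Qed.
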